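(* Let $\mathcal{R}$ and $\mathcal{C}$ be $\alpha$-passive reflection and connection maps. Then for every time limited excitation $e$ (i.e. every function $e:I\to\mathcal{L}$ supported on a finite interval $[0,N\tau)\subset I$, $N\in\mathbb{N}_{+}$), the DSC process $z=(z_{in},z_{out})$ excited with $e$ and generated by $\mathcal{R}$ and $\mathcal{C}$ is uniformly bounded on $I\cup J$, hence stable.
   Context: $\mathcal{L}$ is a real or complex linear space with norm $\|\cdot\|$, and $\mathcal{L}^{2}$ carries the norm $\|(a,b)\|^{\sim}=\sqrt{\|a\|^{2}+\|b\|^{2}}$ (or any equivalent norm). $\tau>0$ is a real number, $I=\{k\tau\mid k\in\mathbb{Z}\}$ and $J=\{(2k+1)\tau/2\mid k\in\mathbb{Z}\}$. Each of $I$ and $J$ carries the measure $\mu$ giving weight $\tau$ to every point. $\alpha:\mathcal{L}\to\mathbb{R}$ is a continuous non-negative functional which is delimiting, i.e. there exist non-negative real constants $a,b,c$ with $\|z\|\leqslant a+b\,(\alpha(z))^{c}$ for every $z\in\mathcal{L}$. The space of propagating fields is $\mathcal{P}=\mathcal{P}_{in}\times\mathcal{P}_{out}$, where the incident and outgoing subspaces $\mathcal{P}_{in}$, $\mathcal{P}_{out}$ are both identified with $\mathcal{L}$ as normed spaces; the node-boundary map $nb$ is the canonical involutary isomorphism of $\mathcal{P}$ interchanging the two factors, $nb(z_{in},z_{out})=(z_{out},z_{in})$. A connection map $\mathcal{C}$ assigns to $t\in I$ and a back-in-time sequence $(z_{out}(t-\kappa\tau))_{\kappa=0}^{\infty}$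 of outgoing fields (sampled at points of $I$) an incident field in $\mathcal{P}_{in}$; a reflection map $\mathcal{R}$ assigns to $t\in J$ and a back-in-time sequence $(z_{in}(t-\kappa\tau))_{\kappa=0}^{\infty}$ of incident fields (sampled at points of $J$) an outgoing field in $\mathcal{P}_{out}$. With the identifications with $\mathcal{L}$ via $nb$, they define maps $F_{C}:\mathcal{L}^{I}\to\mathcal{L}^{I}$, $(F_{C}f)(t)=nb\circ\mathcal{C}\bigl(t,(f(t-\kappa\tau))_{\kappa\ge 0}\bigr)$, and $F_{R}:\mathcal{L}^{J}\to\mathcal{L}^{J}$, $(F_{R}g)(t)=nb\circ\mathcal{R}\bigl(t,(g(t-\kappa\tau))_{\kappa\ge 0}\bigr)$. These maps are causal, i.e. $(Ff)(t)$ is unchanged when $f$ is replaced by $\chi_{s\leqslant t}(s)f(s)$ (equal to $f(s)$ for $s\leqslant t$ and $0$ for $s>t$). For $K\in\{I,J\}$, a causal function $F:\mathcal{L}^{K}\to\mathcal{L}^{K}$ is $\alpha$-passive iff for every $f\in\mathcal{L}^{K}$ and $t\in K$, $\int_{s<t}\alpha((Ff)(s))\,d\mu(s)\leqslant\int_{s<t}\alpha(f(s))\,d\mu(s)$. The reflection map $\mathcal{R}$ (connection map $\mathcal{C}$) is called $\alpha$-passive iff $F_{R}$ (respectively $F_{C}$) is $\alpha$-passive. $T_{q}$ denotes the shift $(T_{q}f)(t)=f(t+q)$; for $q\in J$ it takes functions on $I$ to functions on $J$ and vice versa. For $e:I\to\mathcal{L}$ supported on $[0,N\tau)\subset I$,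 the DSC process excited with $e$ and generated by $\mathcal{R}$ and $\mathcal{C}$ is the unique function $z=(z_{in},z_{out}):I\cup J\to\mathcal{L}^{2}$ with $z(t)=0$ for $t\leqslant 0$ and, recursively for $0\leqslant t\in I\cup J$, $$z\bigl(t+\tfrac{\tau}{2}\bigr)=\begin{cases}\bigl(z_{in}(t),\;T_{-\tau/2}F_{R}T_{-\tau/2}[\,e+z_{in}\,](t)\bigr)&\text{if }t\in I,\\[2pt]\bigl(T_{-\tau/2}F_{C}T_{-\tau/2}[\,z_{out}\,](t),\;z_{out}(t)\bigr)&\text{if }t\in J,\end{cases}$$ where $z_{in}$ inside $F_{R}$ is restricted to $I$ and $z_{out}$ inside $F_{C}$ is restricted to $J$. A process is stable iff it is uniformly bounded in norm.
   Formalization: The formal theorem adds the hypothesis α(0)=0; without it the claim fails (𝓛=ℝ, α(x)=1+|x|, 𝒞=0, 𝓡(t,·)=t: both passivity integrals over the infinite past are always +∞, yet z_out is unbounded). *)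

(* Defs.v *)
From HB Require Import structures.
From mathcomp Require Import all_boot all_order all_algebra.
From mathcomp Require Import complex.
From mathcomp Require Import all_classical all_reals all_analysis.
From mathcomp Require Import ring lra.

Set Implicit Arguments.
Unset Strict Implicit.
Unset Printing Implicit Defensive.

Import Order.TTheory GRing.Theory Num.Theory.
Import numFieldNormedType.Exports.

Local Open Scope classical_set_scope.
Local Open Scope ring_scope.

Variant scalar_kind := RealScalars | ComplexScalars.

Definition scalars (R : realType) (k : scalar_kind) : numFieldType :=
  match k with
  | RealScalars => R
  | ComplexScalars => complex R
  end.

(* The library norm of a normed module takes its values in the field of
   scalars; over the complex numbers such a value lies on the real axis and
   is read as a real number through [Re]. *)
Definition real_part (R : realType) (k : scalar_kind) : scalars R k -> R :=
  match k with
  | RealScalars => fun x => x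
  | ComplexScalars => fun x => complex.Re x
  end.

Definition rnorm (R : realType) (k : scalar_kind)
    (L : normedModType (scalars R k)) (x : L) : R :=
  real_part `|x|.

(* The library norm on [L * L] is the max norm, hence the explicit formula. *)
Definition rnorm2 (R : realType) (k : scalar_kind)
    (L : normedModType (scalars R k)) (z : L * L) : R :=
  Num.sqrt (rnorm z.1 ^+ 2 + rnorm z.2 ^+ 2).

Definition delimiting (R : realType) (k : scalar_kind)
    (L : normedModType (scalars R k)) (alpha : L -> R) : Prop :=
  exists a b c : R, [/\ 0 <= a, 0 <= b, 0 <= c &
    forall x : L, rnorm x <= a + b * (alpha x) `^ c].

Variant grid := GridI | GridJ.

Definition other (K : grid) : grid :=
  match K with GridI => GridJ | GridJ => GridI end.

Definition grid_set (R : realType) (tau : {posnum R}) (K : grid) : set R :=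
  match K with
  | GridI => [set t | exists k : int, t = k%:~R * tau%:num]
  | GridJ => [set t | exists k : int, t = (2 * k + 1)%:~R * tau%:num / 2]
  end.

Definition instant (R : realType) (tau : {posnum R}) (K : grid) : Type :=
  set_type (grid_set tau K).

Definition time (R : realType) (tau : {posnum R}) (K : grid)
    (t : instant tau K) : R := sval t.

HB.instance Definition _ (R : realType) (tau : {posnum R}) (K : grid) :=
  Choice.on (instant tau K).

Lemma grid_point_proof (R : realType) (tau : {posnum R}) (K : grid) :
  grid_set tau K
    (match K with GridI => 0 | GridJ => tau%:num / 2 end).
Proof. by case: K; exists 0; rewrite ?mulr0 ?add0r ?mul0r ?mul1r. Qed.

HB.instance Definition _ (R : realType) (tau : {posnum R}) (K : grid) :=
  isPointed.Build (instant tau K) (SigSub (mem_set (grid_point_proof tau K))).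

HB.instance Definition _ (R : realType) (tau : {posnum R}) (K : grid) :=
  @isMeasurable.Build default_measure_display (instant tau K)
    discrete_measurable discrete_measurable0
    discrete_measurableC discrete_measurableU.

(* Each point has mass [tau]. *)
Definition grid_measure (R : realType) (tau : {posnum R}) (K : grid) :
    {measure set (instant tau K) -> \bar R} :=
  mscale (tau%:num)%:nng (@counting (instant tau K) R).

Lemma back_proof (R : realType) (tau : {posnum R}) (K : grid)
    (t : instant tau K) (kappa : nat) :
  grid_set tau K (time t - kappa%:R * tau%:num).
Proof.
case: K t => -[t /= /set_mem[k ->]]; exists (k - kappa%:Z);
  rewrite !(rmorphD, rmorphM, rmorphN) /= -?pmulrn; by [ring | field].
Qed.

Definition back (R : realType) (tau : {posnum R}) (K : grid)
    (t : instant tau K) (kappa : nat) : instant tau K :=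
  SigSub (mem_set (back_proof t kappa)).

Lemma tplus_proof (R : realType) (tau : {posnum R}) (K : grid)
    (t : instant tau K) (q : instant tau GridJ) :
  grid_set tau (other K) (time t + time q).
Proof.
case: q => q /= /set_mem[j ->].
case: K t => -[t /= /set_mem[k ->]].
  by exists (k + j); rewrite !(rmorphD, rmorphM) /=; field.
by exists (k + j + 1); rewrite !(rmorphD, rmorphM) /=; field.
Qed.

Definition tplus (R : realType) (tau : {posnum R}) (K : grid)
    (t : instant tau K) (q : instant tau GridJ) : instant tau (other K) :=
  SigSub (mem_set (tplus_proof t q)).

(* The shift by [q] in the odd half-grid, exchanging functions on the two
   grids: (T_q f)(t) = f (t + q). *)
Definition T_shift (R : realType) (tau : {posnum R}) (L : Type) (K : grid)
    (q : instant tau GridJ) (f : instant tau (other K) -> L) :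
    instant tau K -> L :=
  fun t => f (tplus t q).

Lemma half_tau_proof (R : realType) (tau : {posnum R}) :
  grid_set tau GridJ (tau%:num / 2).
Proof. by exists 0; rewrite mulr0 add0r mul1r. Qed.

Definition half_tau (R : realType) (tau : {posnum R}) : instant tau GridJ :=
  SigSub (mem_set (half_tau_proof tau)).

Lemma minus_half_tau_proof (R : realType) (tau : {posnum R}) :
  grid_set tau GridJ (- (tau%:num / 2)).
Proof. by exists (-1); rewrite (_ : 2 * -1 + 1 = -1 :> int) // mulN1r mulNr. Qed.

Definition minus_half_tau (R : realType) (tau : {posnum R}) : instant tau GridJ :=
  SigSub (mem_set (minus_half_tau_proof tau)).

Definition causal (R : realType) (tau : {posnum R}) (L : nmodType) (K : grid)
    (F : (instant tau K -> L) -> (instant tau K -> L)) : Prop :=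
  forall (f : instant tau K -> L) (t : instant tau K),
    F f t = F (fun s => if time s <= time t then f s else 0) t.

Definition past (R : realType) (tau : {posnum R}) (K : grid)
    (t : instant tau K) : set (instant tau K) :=
  [set s | time s < time t].

(* The integrals range over an infinite past and take values in [0, +oo]; the
   inequality is void for [f] whenever the right-hand side is infinite. *)
Definition alpha_passive_fun (R : realType) (tau : {posnum R}) (L : nmodType)
    (alpha : L -> R) (K : grid)
    (F : (instant tau K -> L) -> (instant tau K -> L)) : Prop :=
  causal F /\
  forall (f : instant tau K -> L) (t : instant tau K),
    (\int[grid_measure tau K]_(s in past t) (alpha (F f s))%:E <=
     \int[grid_measure tau K]_(s in past t) (alpha (f s))%:E)%E.

(* Propagating fields are pairs (incident, outgoing); an element of [L] is
   identified with an element of either factor through [in_field] and [out_field]. *)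
Definition in_field (L : nmodType) (x : L) : L * L := (x, 0).
Definition out_field (L : nmodType) (x : L) : L * L := (0, x).
Definition nb (L : Type) (z : L * L) : L * L := (z.2, z.1).

(* Argument: time and back-in-time sequence of outgoing fields;
   value: an incident field. *)
Definition connection_map (R : realType) (tau : {posnum R}) (L : Type) : Type :=
  instant tau GridI -> (nat -> L) -> L.

(* Argument: time and back-in-time sequence of incident fields;
   value: an outgoing field. *)
Definition reflection_map (R : realType) (tau : {posnum R}) (L : Type) : Type :=
  instant tau GridJ -> (nat -> L) -> L.

Definition F_C (R : realType) (tau : {posnum R}) (L : nmodType)
    (C : connection_map tau L) (f : instant tau GridI -> L) :
    instant tau GridI -> L :=
  fun t => (nb (in_field (C t (fun kappa => f (back t kappa))))).2.

Definition F_R (R : realType) (tau : {posnum R}) (L : nmodType)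
    (Rf : reflection_map tau L) (g : instant tau GridJ -> L) :
    instant tau GridJ -> L :=
  fun t => (nb (out_field (Rf t (fun kappa => g (back t kappa))))).1.

Lemma back_le (R : realType) (tau : {posnum R}) (K : grid)
    (t : instant tau K) (kappa : nat) : time (back t kappa) <= time t.
Proof. by rewrite /time /= gerBl mulr_ge0. Qed.

Lemma F_C_causal (R : realType) (tau : {posnum R}) (L : nmodType)
    (C : connection_map tau L) : causal (F_C C).
Proof.
move=> f t; rewrite /F_C; congr (nb (in_field (C t _))).2.
by apply/funext => kappa; rewrite back_le.
Qed.

Lemma F_R_causal (R : realType) (tau : {posnum R}) (L : nmodType)
    (Rf : reflection_map tau L) : causal (F_R Rf).
Proof.
move=> f t; rewrite /F_R; congr (nb (out_field (Rf t _))).1.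
by apply/funext => kappa; rewrite back_le.
Qed.

Definition alpha_passive_connection (R : realType) (tau : {posnum R})
    (L : nmodType) (alpha : L -> R) (C : connection_map tau L) : Prop :=
  alpha_passive_fun alpha (F_C C).

Definition alpha_passive_reflection (R : realType) (tau : {posnum R})
    (L : nmodType) (alpha : L -> R) (Rf : reflection_map tau L) : Prop :=
  alpha_passive_fun alpha (F_R Rf).

Definition time_limited (R : realType) (tau : {posnum R}) (L : nmodType)
    (e : instant tau GridI -> L) : Prop :=
  exists2 N : nat, (0 < N)%N &
    forall t : instant tau GridI,
      ~~ (0 <= time t < N%:R * tau%:num) -> e t = 0.

Definition timeIJ (R : realType) (tau : {posnum R}) : Type :=
  set_type (grid_set tau GridI `|` grid_set tau GridJ).

Definition timeIJ_val (R : realType) (tau : {posnum R}) (t : timeIJ tau) : R :=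
  sval t.

Lemma inIJ_proof (R : realType) (tau : {posnum R}) (K : grid)
    (t : instant tau K) :
  (grid_set tau GridI `|` grid_set tau GridJ) (time t).
Proof. by case: K t => -[t /= /set_mem]; [left | right]. Qed.

Definition inIJ (R : realType) (tau : {posnum R}) (K : grid)
    (t : instant tau K) : timeIJ tau :=
  SigSub (mem_set (inIJ_proof t)).

(* [z] is the DSC process excited with [e] and generated by [Rf] and [C]:
   the initial condition and the two branches of the recursion. Every point of
   the union of the grids is either non-positive or of the form t + tau / 2
   with 0 <= t in that union, so these clauses determine [z]. *)
Definition is_DSC_process (R : realType) (tau : {posnum R}) (L : nmodType)
    (Rf : reflection_map tau L) (C : connection_map tau L)
    (e : instant tau GridI -> L) (z : timeIJ tau -> L * L) : Prop :=
  let z_in := fun t => (z t).1 in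
  let z_out := fun t => (z t).2 in
  [/\ forall t : timeIJ tau, timeIJ_val t <= 0 -> z t = (0, 0),
      forall t : instant tau GridI, 0 <= time t ->
        z (inIJ (tplus t (half_tau tau))) =
          (z_in (inIJ t),
           T_shift (K := GridI) (minus_half_tau tau)
             (F_R Rf (T_shift (K := GridJ) (minus_half_tau tau)
               (fun s : instant tau GridI => e s + z_in (inIJ s)))) t)
    & forall t : instant tau GridJ, 0 <= time t ->
        z (inIJ (tplus t (half_tau tau))) =
          (T_shift (K := GridJ) (minus_half_tau tau)
             (F_C C (T_shift (K := GridI) (minus_half_tau tau)
               (fun s : instant tau GridJ => z_out (inIJ s)))) t,
           z_out (inIJ t))].

Definition stable (R : realType) (k : scalar_kind)
    (L : normedModType (scalars R k)) (tau : {posnum R})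
    (z : timeIJ tau -> L * L) : Prop :=
  exists M : R, forall t : timeIJ tau, rnorm2 (z t) <= M.

(* Main.v *)
Require Import Defs.
From mathcomp Require Import all_boot all_order all_algebra.
From mathcomp Require Import complex.
From mathcomp Require Import all_classical all_reals all_analysis.
From mathcomp Require Import ring lra.
Import Order.TTheory GRing.Theory Num.Theory.
Import numFieldNormedType.Exports.
Local Open Scope classical_set_scope.
Local Open Scope ring_scope.

(** Read [alpha] as an energy. In half-steps the process is a pair of
    sequences: the incident fields [a_n], present at [n tau] and kept for half
    a step, and the outgoing fields [b_n], present at [(n + 1/2) tau] and kept
    for half a step. The recursion says that [b_n] is the value of [F_R] one
    step earlier, applied to the excited sequence [e + a], and that [a_(n+1)]
    is the value of [F_C] applied to [b] delayed by one step. Since everything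
    vanishes in the remote past and [alpha 0 = 0], the right-hand integrals
    in the passivity inequalities are finite sums, and the left-hand ones
    dominate the finite sums of interest ([passive_sum_le]), hence
      [sum_(i <= n) alpha b_i <= sum_(i < n) alpha (e_i + a_i)] and
      [sum_(i <= n) alpha a_(i+1) <= sum_(i < n) alpha b_i].

    Let [E] be the energy [sum_(i < N) alpha (e_i + a_i)] present while the
    excitation lasts. Afterwards [e_i + a_i = a_i], so chaining the two
    inequalities bounds the incident energy up to [n + 1] by [E] plus the
    incident energy up to [n - 1]. This does not bound the total energy, which
    may grow linearly, but it does bound its last increments: cancelling the
    common part leaves [alpha a_n <= E] and [alpha b_n <= E]
    ([incident_energy_le], [outgoing_energy_le]). As [alpha] is delimiting,
    its sublevel set at [E] is bounded in norm
    ([delimiting_sublevel_bounded]). *)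

Set Implicit Arguments.
Unset Strict Implicit.

(** * Cancellation in the energy balance *)

(** The energies of the incident ([u]), outgoing ([v]) and excited incident
    ([w]) sequences, as real sequences; [N] is the end of the excitation. *)
Section EnergyBalance.
Variables (R : realType) (u v w : nat -> R) (N : nat).
Hypotheses (u_ge0 : forall n, 0 <= u n) (v_ge0 : forall n, 0 <= v n)
  (w_ge0 : forall n, 0 <= w n).
Hypotheses (u0 : u 0%N = 0) (w_late : forall n, (N <= n)%N -> w n = u n).
Hypothesis reflect_le : forall n,
  \sum_(i < n.+1) v i <= \sum_(i < n) w i.
Hypothesis connect_le : forall n,
  \sum_(i < n.+1) u i.+1 <= \sum_(i < n) v i.

Lemma sum_excited_le n : \sum_(i < n) w i <= \sum_(i < N) w i + \sum_(i < n) u i.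
Proof.
elim: n => [|n IHn]; first by rewrite !big_ord0 addr0 sumr_ge0.
have [Nn|nN] := leqP N n.
  by rewrite !(big_ord_recr n) /= addrA w_late // lerD2r.
apply: (@le_trans _ _ (\sum_(i < N) w i)); last by rewrite lerDl sumr_ge0.
by rewrite -(subnKC nN) [leRHS]big_split_ord /= lerDl sumr_ge0.
Qed.

Lemma connect_shift_le n : \sum_(i < n.+2) u i <= \sum_(i < n) v i.
Proof. by rewrite big_ord_recl /= u0 add0r; exact: connect_le. Qed.

(** The sum of [u] up to [n + 1] is at most [E] plus the sum of [u] below [n],
    so the two further terms [u n] and [u n.+1] are together at most [E]. *)
Lemma incident_energy_le n : u n <= \sum_(i < N) w i.
Proof.
case: n => [|n]; first by rewrite u0 sumr_ge0.
have sum_vw : \sum_(i < n) v i <= \sum_(i < n) w i.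
  apply: le_trans (reflect_le n).
  by rewrite big_ord_recr /= lerDl.
have := connect_shift_le n; rewrite !big_ord_recr /=.
have := sum_excited_le n; have := u_ge0 n.
lra.
Qed.

(** The sum of [v] up to [n] is at most [E] plus the sum of [u] below [n], and
    the latter is at most the sum of [v] below [n]. *)
Lemma outgoing_energy_le n : v n <= \sum_(i < N) w i.
Proof.
have := connect_shift_le n; rewrite !big_ord_recr /=.
have := reflect_le n; rewrite big_ord_recr /=.
have := sum_excited_le n; have := u_ge0 n; have := u_ge0 n.+1.
lra.
Qed.

End EnergyBalance.

(** * Sublevel sets of a delimiting functional *)

Section RealNorm.
Variables (R : realType) (k : scalar_kind) (L : normedModType (scalars R k)).

Lemma rnorm_ge0 (x : L) : 0 <= rnorm x.
Proof.
rewrite /rnorm; have := normr_ge0 x.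
case: k L x => //= L' x; rewrite lecE => /andP[_].
exact.
Qed.

Lemma rnorm2_le (x y : L) (B : R) : rnorm x <= B -> rnorm y <= B ->
  rnorm2 (x, y) <= Num.sqrt (B ^+ 2 + B ^+ 2).
Proof.
move=> xB yB; apply: ler_wsqrtr.
have B0 : 0 <= B := le_trans (rnorm_ge0 x) xB.
by apply: lerD; rewrite lerXn2r // nnegrE ?rnorm_ge0.
Qed.

Lemma delimiting_sublevel_bounded (alpha : L -> R) (E : R) :
  (forall x, 0 <= alpha x) -> delimiting alpha ->
  exists B : R, forall x, alpha x <= E -> rnorm x <= B.
Proof.
move=> alpha_ge0 [a [b [c [a0 b0 c0 le_alpha]]]].
exists (a + b * E `^ c) => x xE.
apply: le_trans (le_alpha x) _; rewrite lerD2l ler_wpM2l //.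
apply: ge0_ler_powR => //; rewrite nnegrE //.
exact: le_trans xE.
Qed.

End RealNorm.

(** * Passivity as an inequality between finite sums *)

Section Grid.
Variables (R : realType) (tau : {posnum R}).

Definition grid_offset (K : grid) : R :=
  match K with GridI => 0 | GridJ => tau%:num / 2 end.

Lemma grid_point_subproof K (m : int) :
  grid_set tau K (m%:~R * tau%:num + grid_offset K).
Proof.
case: K; exists m => /=; rewrite ?addr0 //.
by rewrite rmorphD rmorphM /=; field.
Qed.

Definition grid_pt K (m : int) : instant tau K :=
  SigSub (mem_set (grid_point_subproof K m)).

Lemma time_grid_pt K m : time (grid_pt K m) = m%:~R * tau%:num + grid_offset K.
Proof. by []. Qed.

(** Grid instants carry their membership proof, so all equalities between
    shifted instants are reduced to equalities of real numbers. *)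
Lemma time_inj K : injective (@time R tau K).
Proof. exact: val_inj. Qed.

Lemma grid_pt_surj K (t : instant tau K) : exists m, t = grid_pt K m.
Proof.
case: K t => -[t t_in]; have := t_in => /set_mem /= [m tE]; exists m;
  apply: time_inj; rewrite time_grid_pt /time /= tE ?addr0 //.
by rewrite rmorphD rmorphM /=; field.
Qed.

Lemma time_grid_pt_lt K m n :
  (time (grid_pt K m) < time (grid_pt K n)) = (m < n).
Proof. by rewrite !time_grid_pt ltrD2r ltr_pM2r // ltr_int. Qed.

Lemma grid_pt_inj K : injective (grid_pt K).
Proof.
move=> m n mn; apply/eqP; rewrite eq_le.
by rewrite !leNgt -!(time_grid_pt_lt K) mn ltxx.
Qed.

Lemma grid_integral_singleton K (x : instant tau K) (f : instant tau K -> R) :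
  (\int[grid_measure tau K]_(s in [set x]) (f s)%:E = (tau%:num * f x)%:E)%E.
Proof.
rewrite (@eq_integral _ _ _ _ [set x] (cst (f x)%:E)); last first.
  by move=> s /set_mem ->.
rewrite integral_cst // /grid_measure /= /mscale /= /counting.
by case: asboolP => [_|[]//]; rewrite fset_set1 finmap.cardfs1 mule1 muleC EFinM.
Qed.

Lemma grid_integral_seq K (s : seq (instant tau K)) (f : instant tau K -> R) :
  uniq s -> (forall x, 0 <= f x) ->
  (\int[grid_measure tau K]_(x in [set` s]) (f x)%:E =
   (tau%:num * \sum_(x <- s) f x)%:E)%E.
Proof.
move=> s_uniq f_ge0.
have -> : [set` s] = \big[setU/set0]_(x <- s) [set x].
  by rewrite -bigcup_seq; apply/seteqP; split=> x /=; [exists x | case=> y /= + ->].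
rewrite ge0_integral_bigsetU //=.
- by rewrite mulr_sumr -sumEFin; apply: eq_bigr => x _; apply: grid_integral_singleton.
- by move=> x y _ _ [t [/= <- <-]].
- by move=> x _; rewrite lee_fin.
Qed.

Section Passive.
Variables (L : nmodType) (alpha : L -> R) (K : grid).
Variable F : (instant tau K -> L) -> (instant tau K -> L).
Hypotheses (alpha_ge0 : forall x, 0 <= alpha x).
Hypothesis F_passive : alpha_passive_fun alpha F.

(** A signal without energy before index [0] makes the right-hand integral
    finite, so that the passivity inequality has content. The left-hand
    integral is only bounded below, by any finite window ending at [n - 1];
    starting it [p] steps early keeps track of the output of [F] at negative
    indices, which [causal] alone does not force to vanish. *)
Lemma passive_sum_le (f : instant tau K -> L) (p n : nat) :
  (forall m : int, m < 0 -> alpha (f (grid_pt K m)) = 0) ->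
  \sum_(i < p + n) alpha (F f (grid_pt K (i%:Z - p%:Z))) <=
  \sum_(i < n) alpha (f (grid_pt K i)).
Proof.
move=> f_null_past.
pose window q r := [seq grid_pt K (i%:Z - q%:Z) | i <- iota 0 r].
have window_uniq q r : uniq (window q r).
  rewrite map_inj_uniq ?iota_uniq // => i j /grid_pt_inj.
  by move=> /(@addIr _ _ _ _) [].
have sum_window q r (g : instant tau K -> R) :
    \sum_(x <- window q r) g x = \sum_(i < r) g (grid_pt K (i%:Z - q%:Z)).
  by rewrite big_map -{1}(subn0 r) big_mkord.
have window_past q r : (r <= q + n)%N -> [set` window q r] `<=` past (grid_pt K n).
  move=> rqn x /= /mapP[j]; rewrite mem_iota add0n => /andP[_ jr] ->.
  rewrite /past /= time_grid_pt_lt ltrBlDr -PoszD ltz_nat addnC.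
  exact: leq_trans jr rqn.
have [_ /(_ f (grid_pt K n))] := F_passive.
have -> : (\int[grid_measure tau K]_(s in past (grid_pt K n)) (alpha (f s))%:E =
    \int[grid_measure tau K]_(s in [set` window 0%N n]) (alpha (f s))%:E)%E.
  rewrite integral_mkcond [RHS]integral_mkcond; apply: eq_integral => s _.
  rewrite /patch; case: ifPn => [/set_mem|/negP] s_past; case: ifPn => [/set_mem|/negP] s_window //.
  - have [m sE] := grid_pt_surj s; rewrite sE in s_past s_window *.
    have [m0|m0] := ltP m 0; first by rewrite f_null_past.
    exfalso; apply: s_window; apply/mem_set; apply/mapP; exists `|m|%N.
      rewrite mem_iota /= -ltz_nat gez0_abs //.
      by rewrite /past /= time_grid_pt_lt in s_past.
    by rewrite subr0 gez0_abs.
  - by exfalso; apply: s_past; apply/mem_set/(window_past 0%N n).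
rewrite grid_integral_seq // sum_window.
under eq_bigr do rewrite subr0.
move=> le_int.
have : (\int[grid_measure tau K]_(s in [set` window p (p + n)%N]) (alpha (F f s))%:E <=
    (tau%:num * \sum_(i < n) alpha (f (grid_pt K i)))%:E)%E.
  apply: le_trans le_int; apply: ge0_subset_integral => //.
  - by move=> x _; rewrite lee_fin.
  - exact: window_past.
by rewrite grid_integral_seq // sum_window lee_fin ler_pM2l.
Qed.

End Passive.
End Grid.

(** * Boundedness of the process *)

Theorem theorem2 (R : realType) (k : scalar_kind)
    (L : normedModType (scalars R k)) (tau : {posnum R})
    (alpha : L -> R)
    (alpha_continuous : continuous alpha)
    (alpha_ge0 : forall x : L, 0 <= alpha x)
    (alpha_delimiting : delimiting alpha)
    (alpha0 : alpha 0 = 0)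
    (Rf : reflection_map tau L) (C : connection_map tau L)
    (Rf_passive : alpha_passive_reflection alpha Rf)
    (C_passive : alpha_passive_connection alpha C)
    (e : instant tau GridI -> L) (e_time_limited : time_limited e)
    (z : timeIJ tau -> L * L) (z_process : is_DSC_process Rf C e z) :
  stable z.
Proof.
case: z_process => z_init stepI stepJ.
case: e_time_limited => N _ e_late.
set zI := fun m => z (inIJ (grid_pt tau GridI m)).
set zJ := fun m => z (inIJ (grid_pt tau GridJ m)).
have zI_init m : m <= 0 -> zI m = (0, 0).
  move=> m0; apply: z_init; rewrite /timeIJ_val /= addr0.
  by rewrite pmulr_lle0 // lerz0.
have zJ_init m : m < 0 -> zJ m = (0, 0).
  move=> m0; apply: z_init; rewrite /timeIJ_val /=.
  have : m + 1 <= 0 by rewrite lezD1.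
  rewrite -(lerz0 R) rmorphD /= => m1.
  have : (m%:~R + 1) * tau%:num <= 0 :> R by rewrite pmulr_lle0.
  have tau_gt0 : 0 < tau%:num :> R by [].
  by lra.
set g := T_shift (K := GridJ) (minus_half_tau tau)
  (fun s : instant tau GridI => e s + (z (inIJ s)).1).
set h := T_shift (K := GridI) (minus_half_tau tau)
  (fun s : instant tau GridJ => (z (inIJ s)).2).
have gE m : g (grid_pt tau GridJ m) = e (grid_pt tau GridI m) + (zI m).1.
  rewrite /g /T_shift.
  suff -> : tplus (grid_pt tau GridJ m) (minus_half_tau tau) = grid_pt tau GridI m by [].
  by apply: time_inj; rewrite /time /= addr0 addrK.
have hE m : h (grid_pt tau GridI m) = (zJ (m - 1)).2.
  rewrite /h /T_shift.
  suff -> : tplus (grid_pt tau GridI m) (minus_half_tau tau) =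
      grid_pt tau GridJ (m - 1) by [].
  by apply: time_inj; rewrite /time /= rmorphB /=; field.
have zJ_step (n : nat) :
    zJ n = ((zI n).1, F_R Rf g (grid_pt tau GridJ (n%:Z - 1))).
  have := stepI (grid_pt tau GridI n).
  have -> : tplus (grid_pt tau GridI n) (half_tau tau) = grid_pt tau GridJ n.
    by apply: time_inj; rewrite /time /= addr0.
  rewrite -/(zJ n) => ->; last by rewrite time_grid_pt addr0 mulr_ge0.
  rewrite {1}/T_shift; congr (_, F_R Rf g _).
  by apply: time_inj; rewrite /time /= rmorphB /=; field.
have zI_step (n : nat) :
    zI n.+1 = (F_C C h (grid_pt tau GridI n), (zJ n).2).
  have := stepJ (grid_pt tau GridJ n).
  have -> : tplus (grid_pt tau GridJ n) (half_tau tau) = grid_pt tau GridI n.+1.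
    by apply: time_inj; rewrite /time /= -natr1; field.
  rewrite -/(zI n.+1) => ->; last by rewrite time_grid_pt addr_ge0 // mulr_ge0.
  rewrite {1}/T_shift; congr (F_C C h _, _).
  by apply: time_inj; rewrite /time /= addr0 addrK.
have e_out m : (m < 0) || (N%:Z <= m) -> e (grid_pt tau GridI m) = 0.
  move=> m_out; apply: e_late; rewrite time_grid_pt addr0 negb_and -!ltNge -leNgt.
  rewrite pmulr_llt0 // ltrz0 ler_pM2r //.
  by rewrite -[X in _ || (X <= _)]/(N%:Z%:~R) ler_int.
pose u (n : nat) := alpha (zI n).1.
pose v (n : nat) := alpha (zJ n).2.
pose w (n : nat) := alpha (g (grid_pt tau GridJ n)).
have u0 : u 0%N = 0 by rewrite /u zI_init.
have w_late n : (N <= n)%N -> w n = u n.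
  by move=> Nn; rewrite /w gE e_out ?add0r // lez_nat Nn orbT.
have reflect_le n : \sum_(i < n.+1) v i <= \sum_(i < n) w i.
  (* Reflection is delayed by one step, so [v 0] is the output at index -1. *)
  under eq_bigr do rewrite /v zJ_step /=.
  apply: (passive_sum_le alpha_ge0 Rf_passive 1) => m m0.
  by rewrite gE zI_init ?ltW // e_out ?m0 // add0r.
have connect_le n : \sum_(i < n.+1) u i.+1 <= \sum_(i < n) v i.
  under eq_bigr do rewrite /u zI_step /=.
  have -> : \sum_(i < n) v i = \sum_(i < n.+1) alpha (h (grid_pt tau GridI i)).
    (* The delayed input of the connection map is null at index 0. *)
    rewrite big_ord_recl hE zJ_init //= alpha0 add0r.
    by apply: eq_bigr => i _; rewrite hE /bump /= add1n -addn1 PoszD addrK.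
  have h_early m : m < 0 -> alpha (h (grid_pt tau GridI m)) = 0.
    by move=> m0; rewrite hE zJ_init //= ltrBlDr (lt_trans m0).
  apply: le_trans (passive_sum_le alpha_ge0 C_passive 0 n.+1 h_early).
  by under [leRHS]eq_bigr do rewrite subr0.
have u_ge0 n : 0 <= u n := alpha_ge0 _.
have v_ge0 n : 0 <= v n := alpha_ge0 _.
have w_ge0 n : 0 <= w n := alpha_ge0 _.
have uE n : u n <= \sum_(i < N) w i by exact: (incident_energy_le (v := v)).
have vE n : v n <= \sum_(i < N) w i by exact: (outgoing_energy_le (u := u)).
have [B normB] := delimiting_sublevel_bounded (\sum_(i < N) w i) alpha_ge0 alpha_delimiting.
have B0 : rnorm (0 : L) <= B by apply: normB; rewrite alpha0 sumr_ge0.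
have zI_le m : rnorm2 (zI m) <= Num.sqrt (B ^+ 2 + B ^+ 2).
  have [m0|] := leP m 0; first by rewrite zI_init //; exact: rnorm2_le.
  case: m => // -[//|n] _.
  rewrite [zI _]surjective_pairing; apply: rnorm2_le; apply: normB; first exact: uE.
  by rewrite zI_step; exact: vE.
have zJ_le m : rnorm2 (zJ m) <= Num.sqrt (B ^+ 2 + B ^+ 2).
  have [m0|] := ltP m 0; first by rewrite zJ_init //; exact: rnorm2_le.
  case: m => // n _.
  rewrite [zJ _]surjective_pairing; apply: rnorm2_le; apply: normB; last exact: vE.
  by rewrite zJ_step; exact: uE.
exists (Num.sqrt (B ^+ 2 + B ^+ 2)) => t.
have [[s tE]|[s tE]] : (exists s : instant tau GridI, t = inIJ s) \/
    (exists s : instant tau GridJ, t = inIJ s).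
  case: t => t t_in; case: (set_mem t_in) => tK; [left|right];
    by exists (SigSub (mem_set tK)); apply: val_inj.
- by have [m sE] := grid_pt_surj s; rewrite tE sE; exact: zI_le.
- by have [m sE] := grid_pt_surj s; rewrite tE sE; exact: zJ_le.
Qed.
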